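(* Let $I\subset\mathbb{R}$ be an open interval containing $0$, let $f:I\to\mathbb{S}^2_1$ be a unit speed space-like curve with $\kappa_g^2(v)>1$ for all $v\in I$, let $a\neq0$, $\theta\ne0$, $u>0$ be real constants, $\xi_1=\tanh\theta\,\ln u$, and let $$\tilde\gamma(v)=a\int_0^v f(t)\,dt+a\tanh\xi_1\int_0^v f(t)\times f'(t)\,dt$$ be a space-like Bertrand curve (the space-like Bertrand curve corresponding to $f$). Then the de Sitter Darboux image of $\tilde\gamma$ is equal to the de Sitter evolute of $f$; that is, $C(v)=d_f(v)$ for all $v\in I$.
   Context: Minkowski 3-space $\mathbb{R}^3_1$ is $\mathbb{R}^3$ with $\langle x,y\rangle=x_1y_1+x_2y_2-x_3y_3$ and $\|x\|=\sqrt{|\langle x,x\rangle|}$. A vector $x$ is space-like if $\langle x,x\rangle>0$ or $x=0$, time-like if $\langle x,x\rangle<0$, light-like if $\langle x,x\rangle=0$ and $x\ne0$. A regular curve is space-like (time-like) if all its velocity vectors are; it is unit speed if its velocity has pseudo-norm $1$. Curves are smooth. The Lorentzian cross product $x\times y$ is the vector determined by $\langle x\times y,z\rangle=\det(x,y,z)$ for all $z$. De Sitter 2-space is $\mathbb{S}^2_1=\{x\in\mathbb{R}^3_1:\langle x,x\rangle=1\}$. For a unit speed space-like curve $f$ on $\mathbb{S}^2_1$, put $t=f'$ and $s=f\times t$; its geodesic curvature is $\kappa_g(v)=\det(f(v),t(v),t'(v))$. When $\kappa_g^2>1$, the de Sitter evolute of $f$ is $$d_f(v)=\frac{-\kappa_g(v)f(v)-s(v)}{\sqrt{\kappa_g^2(v)-1}}.$$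 For a space-like curve $\alpha$ (derivatives below taken with respect to arc length), it is assumed throughout that $T'$ is space-like (and nonzero). Its Frenet frame is $T=\alpha'$, $N=\alpha''/\|\alpha''\|$, $B=N\times T$; curvature $\kappa=\|T'\|$, torsion $\tau=-\langle N',B\rangle$. Its Darboux vector is $D=-\tau T+\kappa B$ and, when $D$ is nowhere light-like, its de Sitter Darboux image is $C=D/\|D\|$. Such a curve is a (space-like) Bertrand curve if there are non-zero real constants $A,B$ with $A\kappa+B\tau=1$ everywhere. *)

(* Defs.v *)
(* Stdlib reals with Coquelicot. *)
From Stdlib Require Import Reals Lra ClassicalEpsilon.
From Coquelicot Require Import Coquelicot.
Open Scope R_scope.

Definition vec : Type := R * R * R.

Definition x1 (p : vec) : R := fst (fst p).
Definition x2 (p : vec) : R := snd (fst p).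
Definition x3 (p : vec) : R := snd p.

Definition mdot (p q : vec) : R := x1 p * x1 q + x2 p * x2 q - x3 p * x3 q.
Definition pnorm (p : vec) : R := sqrt (Rabs (mdot p p)).

Definition spacelike (p : vec) : Prop := 0 < mdot p p \/ p = zero.

Definition det3 (p q r : vec) : R :=
  x1 p * (x2 q * x3 r - x3 q * x2 r)
  - x2 p * (x1 q * x3 r - x3 q * x1 r)
  + x3 p * (x1 q * x2 r - x2 q * x1 r).

Definition cross (p q : vec) : vec :=
  (x2 p * x3 q - x3 p * x2 q,
   x3 p * x1 q - x1 p * x3 q,
   - (x1 p * x2 q - x2 p * x1 q)).

(* [cross p q] is the unique vector representing [det3 p q] for [mdot]. *)
Lemma cross_spec (p q w : vec) :
  (forall r, mdot w r = det3 p q r) <-> w = cross p q.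
Proof.
destruct p as [[p1 p2] p3], q as [[q1 q2] q3], w as [[w1 w2] w3].
unfold mdot, det3, cross, x1, x2, x3; simpl; split.
- intros H.
  generalize (H (1, 0, 0)) (H (0, 1, 0)) (H (0, 0, 1)); simpl; intros H1 H2 H3.
  f_equal; [f_equal|]; lra.
- intros [= -> -> ->] [[r1 r2] r3]; simpl; ring.
Qed.

(* Curves are total functions on [R]; only their values on the open interval
   under consideration matter. *)
Definition vDerive (g : R -> vec) (v : R) : vec :=
  (Derive (fun w => x1 (g w)) v,
   Derive (fun w => x2 (g w)) v,
   Derive (fun w => x3 (g w)) v).

(* Oriented integral: the upper bound may be smaller than the lower one. *)
Definition vRInt (g : R -> vec) (p q : R) : vec :=
  (RInt (fun w => x1 (g w)) p q,
   RInt (fun w => x2 (g w)) p q,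
   RInt (fun w => x3 (g w)) p q).

Definition Rbar_interval (lo hi : Rbar) (v : R) : Prop :=
  Rbar_lt lo v /\ Rbar_lt v hi.

Definition smooth_on (I : R -> Prop) (g : R -> vec) : Prop :=
  forall (n : nat) (v : R), I v ->
    ex_derive_n (fun w => x1 (g w)) n v /\
    ex_derive_n (fun w => x2 (g w)) n v /\
    ex_derive_n (fun w => x3 (g w)) n v.

Definition spacelike_curve (I : R -> Prop) (g : R -> vec) : Prop :=
  smooth_on I g /\
  forall v, I v -> vDerive g v <> zero /\ spacelike (vDerive g v).

Definition unit_speed (I : R -> Prop) (g : R -> vec) : Prop :=
  forall v, I v -> pnorm (vDerive g v) = 1.

Definition on_deSitter (I : R -> Prop) (f : R -> vec) : Prop :=
  forall v, I v -> mdot (f v) (f v) = 1.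

Definition geodesic_curvature (f : R -> vec) (v : R) : R :=
  det3 (f v) (vDerive f v) (vDerive (vDerive f) v).

Definition deSitter_evolute (f : R -> vec) (v : R) : vec :=
  let kg := geodesic_curvature f v in
  let s := cross (f v) (vDerive f v) in
  scal (/ sqrt (kg ^ 2 - 1)) (minus (scal (- kg) (f v)) s).

Section UnitSpeedFrenet.

(* A curve parametrized by arc length. *)
Variable alpha : R -> vec.

Definition Tvec : R -> vec := vDerive alpha.

Definition Nvec (s : R) : vec :=
  let alpha'' := vDerive (vDerive alpha) s in scal (/ pnorm alpha'') alpha''.

Definition Bvec (s : R) : vec := cross (Nvec s) (Tvec s).

Definition curvature (s : R) : R := pnorm (vDerive Tvec s).

Definition torsion (s : R) : R := - mdot (vDerive Nvec s) (Bvec s).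

Definition darboux_vector (s : R) : vec :=
  plus (scal (- torsion s) (Tvec s)) (scal (curvature s) (Bvec s)).

Definition darboux_image (s : R) : vec :=
  scal (/ pnorm (darboux_vector s)) (darboux_vector s).

End UnitSpeedFrenet.

(* Arc length measured from the parameter 0, hence meant for intervals
   containing 0. *)
Definition arclength (g : R -> vec) (v : R) : R :=
  RInt (fun w => pnorm (vDerive g w)) 0 v.

(* The arc-length reparametrization of [g] on [I]: it maps [s] to [g v], where
   [v] is the parameter in [I] with [arclength g v = s] (unique when [g] is a
   space-like curve on an interval [I] containing 0); its value at [s] is
   irrelevant if there is no such [v]. *)
Definition arclength_reparam (I : R -> Prop) (g : R -> vec) (s : R) : vec :=
  g (epsilon (inhabits 0) (fun v => I v /\ arclength g v = s)).

(* Bertrand condition for a curve [g] with an arbitrary regular parametrization: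
   the Frenet data are those of its arc-length reparametrization. *)
Definition spacelike_bertrand (I : R -> Prop) (g : R -> vec) : Prop :=
  let alpha := arclength_reparam I g in
  spacelike_curve I g /\
  (forall v, I v ->
     let T' := vDerive (Tvec alpha) (arclength g v) in
     spacelike T' /\ T' <> zero) /\
  exists cA cB : R, cA <> 0 /\ cB <> 0 /\
    forall v, I v ->
      cA * curvature alpha (arclength g v)
      + cB * torsion alpha (arclength g v) = 1.

(* The de Sitter Darboux image of [g] as a function of the given parameter. *)
Definition deSitter_darboux_image (I : R -> Prop) (g : R -> vec) (v : R) : vec :=
  darboux_image (arclength_reparam I g) (arclength g v).

Definition gamma_tilde (f : R -> vec) (a xi : R) (v : R) : vec :=
  plus (scal a (vRInt f 0 v))
       (scal (a * tanh xi) (vRInt (fun w => cross (f w) (vDerive f w)) 0 v)).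

(* Main.v *)
Require Import Defs.
From Stdlib Require Import Reals Lra ClassicalEpsilon.
From Coquelicot Require Import Coquelicot.
Open Scope R_scope.

(** Write [t = f'], [s = f x t] and [k] for the geodesic curvature of [f].
    The triple [(f, t, s)] is orthonormal with [s] time-like, and it satisfies
    [f' = t], [t' = - f - k s], [s' = - k t] (lemmas [vDerive_tangent] and
    [is_vderive_conormal]).  Put [T = tanh xi].  Since
    [gamma' = a (f + T s)] has the constant pseudo-norm
    [c = |a| sqrt (1 - T^2) > 0], the arc length of [gamma] at [v] is [c v], so
    passing to arc length only divides derivatives by [c].  With [b = a / c],
    so that [b^2 (1 - T^2) = 1], the tangent is [b (f + T s)] and its
    derivative is [(b / c) (1 - k T) t].  The latter is nonzero, so the
    principal normal is [d t], where [d] is the sign of [b (1 - k T)] and is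
    locally constant.  The rest is algebra in the frame [(f, t, s)]: up to the
    factor [d], which cancels, the binormal is [- b (s + T f)], and
    [curvature = d b (1 - k T) / c], [torsion = b (k - T) / c], whence the
    Darboux vector is [- (k f + s) / c].  Its normalization is the
    evolute.

    That the acceleration of [gamma] does not vanish enters through
    [1 - k T <> 0]: with the continuity of [k] this makes the sign [d] locally
    constant, so that the principal normal can be differentiated as [d t]. *)

(** * Algebra of Minkowski 3-space *)

Lemma vec_ext (p q : vec) :
  x1 p = x1 q -> x2 p = x2 q -> x3 p = x3 q -> p = q.
Proof.
destruct p as [[p1 p2] p3], q as [[q1 q2] q3]; unfold x1, x2, x3; simpl.
now intros -> -> ->.
Qed.

Ltac vec_unfold :=
  unfold mdot, det3, cross, minus, plus, opp, scal, zero, x1, x2, x3; simpl;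
  unfold prod_plus, prod_opp, prod_scal, prod_zero, mult, plus, opp, scal, zero;
  simpl; unfold mult, plus, opp, scal, zero; simpl.

Ltac vec_ring := apply vec_ext; vec_unfold; ring.

Lemma pnorm_scal (k : R) (p : vec) : pnorm (scal k p) = Rabs k * pnorm p.
Proof.
unfold pnorm.
replace (mdot (scal k p) (scal k p)) with (k * k * mdot p p)
  by (vec_unfold; ring).
rewrite Rabs_mult, sqrt_mult_alt by apply Rabs_pos.
f_equal.
rewrite Rabs_mult.
apply sqrt_square, Rabs_pos.
Qed.

Lemma mdot_cross_cross (p q : vec) :
  mdot (cross p q) (cross p q) = mdot p q ^ 2 - mdot p p * mdot q q.
Proof. vec_unfold; ring. Qed.

(** The usual expansion of a double cross product changes sign in Lorentzian
    signature. *)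
Lemma cross_cross (p q r : vec) :
  cross p (cross q r) = minus (scal (mdot p q) r) (scal (mdot p r) q).
Proof. vec_ring. Qed.

Definition orthonormal_pair (p q : vec) : Prop :=
  mdot p p = 1 /\ mdot q q = 1 /\ mdot p q = 0.

(** Cramer's rule for the basis [(p, q, cross p q)], whose determinant is the
    square [- 1] of its time-like vector [cross p q]. *)
Lemma orthonormal_expansion (p q r : vec) :
  orthonormal_pair p q ->
  r = minus (plus (scal (mdot r p) p) (scal (mdot r q) q))
            (scal (det3 p q r) (cross p q)).
Proof.
intros (Hp & Hq & Hpq).
assert (H : scal (mdot p p * mdot q q - mdot p q ^ 2) r =
  minus (plus (scal (mdot r p * mdot q q - mdot r q * mdot p q) p)
              (scal (mdot r q * mdot p p - mdot r p * mdot p q) q))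
        (scal (det3 p q r) (cross p q))) by vec_ring.
rewrite Hp, Hq, Hpq in H.
transitivity (scal (1 * 1 - 0 ^ 2) r); [vec_ring|].
rewrite H; vec_ring.
Qed.

(** * Differentiation of vector-valued functions *)

Definition is_vderive (g : R -> vec) (v : R) (l : vec) : Prop :=
  is_derive (fun w => x1 (g w)) v (x1 l) /\
  is_derive (fun w => x2 (g w)) v (x2 l) /\
  is_derive (fun w => x3 (g w)) v (x3 l).

Lemma is_vderive_unique (g : R -> vec) (v : R) (l : vec) :
  is_vderive g v l -> vDerive g v = l.
Proof.
intros (H1 & H2 & H3).
apply vec_ext; now apply is_derive_unique.
Qed.

Lemma is_vderive_scal (k : R) (g : R -> vec) (v : R) (l : vec) :
  is_vderive g v l -> is_vderive (fun w => scal k (g w)) v (scal k l).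
Proof.
intros (H1 & H2 & H3).
split; [|split].
- exact (is_derive_scal _ _ k _ H1).
- exact (is_derive_scal _ _ k _ H2).
- exact (is_derive_scal _ _ k _ H3).
Qed.

Lemma is_vderive_plus (g h : R -> vec) (v : R) (l m : vec) :
  is_vderive g v l -> is_vderive h v m ->
  is_vderive (fun w => plus (g w) (h w)) v (plus l m).
Proof.
intros (G1 & G2 & G3) (H1 & H2 & H3).
split; [|split].
- exact (is_derive_plus _ _ _ _ _ G1 H1).
- exact (is_derive_plus _ _ _ _ _ G2 H2).
- exact (is_derive_plus _ _ _ _ _ G3 H3).
Qed.

Lemma is_derive_Rmult (g h : R -> R) (v l m : R) :
  is_derive g v l -> is_derive h v m ->
  is_derive (fun w => g w * h w) v (l * h v + g v * m).
Proof.
intros Hg Hh.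
exact (is_derive_mult g h v l m Hg Hh Rmult_comm).
Qed.

Lemma is_derive_eq (g : R -> R) (v l m : R) :
  is_derive g v l -> l = m -> is_derive g v m.
Proof. now intros H <-. Qed.

Lemma is_derive_Rplus (g h : R -> R) (v l m : R) :
  is_derive g v l -> is_derive h v m -> is_derive (fun w => g w + h w) v (l + m).
Proof. exact (is_derive_plus g h v l m). Qed.

Lemma is_derive_Rminus (g h : R -> R) (v l m : R) :
  is_derive g v l -> is_derive h v m -> is_derive (fun w => g w - h w) v (l - m).
Proof. exact (is_derive_minus g h v l m). Qed.

Lemma is_derive_Ropp (g : R -> R) (v l : R) :
  is_derive g v l -> is_derive (fun w => - g w) v (- l).
Proof. exact (is_derive_opp g v l). Qed.

Ltac derive_polynomial :=
  lazymatch goal with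
  | |- is_derive (fun w => _ + _) _ _ => eapply is_derive_Rplus
  | |- is_derive (fun w => _ - _) _ _ => eapply is_derive_Rminus
  | |- is_derive (fun w => - _) _ _ => eapply is_derive_Ropp
  | |- is_derive (fun w => _ * _) _ _ => eapply is_derive_Rmult
  | |- is_derive _ _ _ => eassumption
  end.

Ltac derive_bilinear :=
  eapply is_derive_eq; [repeat derive_polynomial | vec_unfold; ring].

Lemma is_derive_mdot (g h : R -> vec) (v : R) (l m : vec) :
  is_vderive g v l -> is_vderive h v m ->
  is_derive (fun w => mdot (g w) (h w)) v (mdot l (h v) + mdot (g v) m).
Proof.
intros (G1 & G2 & G3) (H1 & H2 & H3).
unfold mdot; derive_bilinear.
Qed.

Lemma is_vderive_cross (g h : R -> vec) (v : R) (l m : vec) :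
  is_vderive g v l -> is_vderive h v m ->
  is_vderive (fun w => cross (g w) (h w)) v
    (plus (cross l (h v)) (cross (g v) m)).
Proof.
intros (G1 & G2 & G3) (H1 & H2 & H3).
split; [|split].
- change (fun w => x1 (cross (g w) (h w))) with
    (fun w => x2 (g w) * x3 (h w) - x3 (g w) * x2 (h w)).
  derive_bilinear.
- change (fun w => x2 (cross (g w) (h w))) with
    (fun w => x3 (g w) * x1 (h w) - x1 (g w) * x3 (h w)).
  derive_bilinear.
- change (fun w => x3 (cross (g w) (h w))) with
    (fun w => - (x1 (g w) * x2 (h w) - x2 (g w) * x1 (h w))).
  derive_bilinear.
Qed.

Lemma is_derive_rescale (g h : R -> R) (c v l : R) :
  c <> 0 -> locally v (fun w => h (c * w) = g w) ->
  is_derive g v l -> is_derive h (c * v) (/ c * l).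
Proof.
intros Hc Hgh Hg.
apply is_derive_ext_loc with (f := fun y => g (/ c * y)).
- assert (Hcont : continuous (fun y => / c * y) (c * v)).
  { apply (continuous_scal_r (V := R_NormedModule)), continuous_id. }
  assert (Hv : / c * (c * v) = v) by now field.
  unfold continuous in Hcont; rewrite Hv in Hcont.
  generalize (Hcont _ Hgh); unfold filtermap; apply filter_imp.
  intros y <-; f_equal; now field.
- apply (is_derive_comp g (fun y => / c * y) (c * v) l (/ c)).
  + replace (/ c * (c * v)) with v by now field.
    exact Hg.
  + auto_derive; [trivial|ring].
Qed.

(** Only the values of [h] near [c * v] are related to [g], which lets the
    lemma apply to arc-length reparametrizations of curves on an interval. *)
Lemma is_vderive_rescale (g h : R -> vec) (c v : R) (l : vec) :
  c <> 0 -> locally v (fun w => h (c * w) = g w) ->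
  is_vderive g v l -> is_vderive h (c * v) (scal (/ c) l).
Proof.
intros Hc Hgh (G1 & G2 & G3).
split; [|split].
- apply (is_derive_rescale (fun w => x1 (g w)) (fun w => x1 (h w)));
    [exact Hc| |exact G1].
  revert Hgh; apply filter_imp; now intros w ->.
- apply (is_derive_rescale (fun w => x2 (g w)) (fun w => x2 (h w)));
    [exact Hc| |exact G2].
  revert Hgh; apply filter_imp; now intros w ->.
- apply (is_derive_rescale (fun w => x3 (g w)) (fun w => x3 (h w)));
    [exact Hc| |exact G3].
  revert Hgh; apply filter_imp; now intros w ->.
Qed.

Lemma smooth_on_is_vderive (I : R -> Prop) (g : R -> vec) (v : R) :
  smooth_on I g -> I v -> is_vderive g v (vDerive g v).
Proof.
intros Hg Hv.
destruct (Hg 1%nat v Hv) as (H1 & H2 & H3).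
split; [|split]; now apply Derive_correct.
Qed.

Lemma smooth_on_vDerive (I : R -> Prop) (g : R -> vec) :
  smooth_on I g -> smooth_on I (vDerive g).
Proof.
assert (Hshift : forall (h : R -> R) n v,
  ex_derive_n h (S n) v -> ex_derive_n (Derive h) n v).
{ intros h [|n] v; [easy|].
  apply (ex_derive_ext (Derive_n h (S n))); intros w.
  replace (S n) with (n + 1)%nat by ring.
  symmetry; exact (Derive_n_comp h n 1 w). }
intros Hg n v Hv.
destruct (Hg (S n) v Hv) as (H1 & H2 & H3).
split; [|split]; now apply Hshift.
Qed.

(** * Intervals and integrals *)

Lemma locally_Rbar_interval (lo hi : Rbar) (v : R) :
  Rbar_interval lo hi v -> locally v (Rbar_interval lo hi).
Proof.
intros [Hlo Hhi].
now apply (locally_interval _ v lo hi).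
Qed.

Lemma Rbar_interval_between (lo hi : Rbar) (v w z : R) :
  Rbar_interval lo hi v -> Rbar_interval lo hi w ->
  Rmin v w <= z <= Rmax v w -> Rbar_interval lo hi z.
Proof.
intros [Hv1 Hv2] [Hw1 Hw2] [Hz1 Hz2].
split.
- apply Rbar_lt_le_trans with (Rmin v w); [|exact Hz1].
  apply Rmin_case; assumption.
- apply Rbar_le_lt_trans with (Rmax v w); [exact Hz2|].
  apply Rmax_case; assumption.
Qed.

Lemma is_derive_RInt_interval (lo hi : Rbar) (g : R -> R) (v : R) :
  Rbar_interval lo hi 0 ->
  (forall w, Rbar_interval lo hi w -> ex_derive g w) ->
  Rbar_interval lo hi v ->
  is_derive (fun w => RInt g 0 w) v (g v).
Proof.
intros H0 Hg Hv.
apply (is_derive_RInt (V := R_NormedModule) g _ 0).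
- generalize (locally_Rbar_interval _ _ _ Hv); apply filter_imp.
  intros w Hw.
  apply (RInt_correct (V := R_CompleteNormedModule)).
  apply (ex_RInt_continuous (V := R_CompleteNormedModule)).
  intros z Hz.
  apply (ex_derive_continuous (V := R_NormedModule)), Hg.
  now apply (Rbar_interval_between _ _ 0 w).
- now apply (ex_derive_continuous (V := R_NormedModule)), Hg.
Qed.

Lemma is_vderive_vRInt (lo hi : Rbar) (g g' : R -> vec) (v : R) :
  Rbar_interval lo hi 0 ->
  (forall w, Rbar_interval lo hi w -> is_vderive g w (g' w)) ->
  Rbar_interval lo hi v ->
  is_vderive (vRInt g 0) v (g v).
Proof.
intros H0 Hg Hv.
split; [|split].
- apply (is_derive_RInt_interval lo hi (fun w => x1 (g w))); trivial.
  intros w Hw; exists (x1 (g' w)); apply Hg, Hw.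
- apply (is_derive_RInt_interval lo hi (fun w => x2 (g w))); trivial.
  intros w Hw; exists (x2 (g' w)); apply Hg, Hw.
- apply (is_derive_RInt_interval lo hi (fun w => x3 (g w))); trivial.
  intros w Hw; exists (x3 (g' w)); apply Hg, Hw.
Qed.

Lemma arclength_constant_speed (lo hi : Rbar) (g : R -> vec) (c v : R) :
  Rbar_interval lo hi 0 ->
  (forall w, Rbar_interval lo hi w -> pnorm (vDerive g w) = c) ->
  Rbar_interval lo hi v ->
  arclength g v = c * v.
Proof.
intros H0 Hc Hv.
unfold arclength.
rewrite (RInt_ext _ (fun _ => c)).
- rewrite RInt_const; unfold scal; simpl; unfold mult; simpl; ring.
- intros w Hw; apply Hc, (Rbar_interval_between _ _ 0 v); trivial; lra.
Qed.

Lemma arclength_reparam_constant_speed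
    (I : R -> Prop) (g : R -> vec) (c v : R) :
  c <> 0 -> (forall w, I w -> arclength g w = c * w) -> I v ->
  arclength_reparam I g (c * v) = g v.
Proof.
intros Hc Hlen Hv.
unfold arclength_reparam.
destruct (epsilon_spec (inhabits 0) (fun w => I w /\ arclength g w = c * v))
  as [Hw Heq].
{ exists v; split; [exact Hv|now apply Hlen]. }
rewrite Hlen in Heq by exact Hw.
f_equal; now apply Rmult_eq_reg_l with c.
Qed.

(** * The moving frame of a unit speed curve on de Sitter space *)

Lemma pnorm_one_spacelike (p : vec) : spacelike p -> pnorm p = 1 -> mdot p p = 1.
Proof.
intros Hs Hn.
assert (H0 : 0 <= mdot p p).
{ destruct Hs as [Hs| ->]; [lra|vec_unfold; lra]. }
unfold pnorm in Hn.
rewrite Rabs_pos_eq in Hn by exact H0.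
rewrite <- (sqrt_sqrt _ H0), Hn; ring.
Qed.

Lemma mdot_locally_constant (g h : R -> vec) (k v : R) (l m : vec) :
  is_vderive g v l -> is_vderive h v m ->
  locally v (fun w => mdot (g w) (h w) = k) ->
  mdot l (h v) + mdot (g v) m = 0.
Proof.
intros Hg Hh Hk.
transitivity (Derive (fun w => mdot (g w) (h w)) v).
- symmetry; apply is_derive_unique; now apply is_derive_mdot.
- transitivity (Derive (fun _ => k) v).
  + apply Derive_ext_loc, Hk.
  + apply Derive_const.
Qed.

Definition conormal (f : R -> vec) (w : R) : vec := cross (f w) (vDerive f w).

Lemma deSitter_orthonormal (lo hi : Rbar) (f : R -> vec) (v : R) :
  spacelike_curve (Rbar_interval lo hi) f ->
  unit_speed (Rbar_interval lo hi) f ->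
  on_deSitter (Rbar_interval lo hi) f ->
  Rbar_interval lo hi v ->
  orthonormal_pair (f v) (vDerive f v).
Proof.
intros [Hsm Hsp] Hu Hd Hv.
split; [now apply Hd|split].
- apply pnorm_one_spacelike; [now apply Hsp|now apply Hu].
- assert (H := smooth_on_is_vderive _ f v Hsm Hv).
  assert (E := mdot_locally_constant f f 1 v _ _ H H
    (filter_imp _ _ Hd (locally_Rbar_interval _ _ _ Hv))).
  replace (mdot (vDerive f v) (f v)) with (mdot (f v) (vDerive f v)) in E
    by (vec_unfold; ring).
  lra.
Qed.

(** The coefficients of [t'] on [f] and [t] come from differentiating
    [<f, t> = 0] and [<t, t> = 1]; the one on [f x t] is the geodesic
    curvature up to sign, as [f x t] is time-like. *)
Lemma vDerive_tangent (lo hi : Rbar) (f : R -> vec) (v : R) :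
  spacelike_curve (Rbar_interval lo hi) f ->
  unit_speed (Rbar_interval lo hi) f ->
  on_deSitter (Rbar_interval lo hi) f ->
  Rbar_interval lo hi v ->
  vDerive (vDerive f) v =
  minus (opp (f v)) (scal (geodesic_curvature f v) (conormal f v)).
Proof.
intros Hc Hu Hd Hv.
assert (Hon : forall w, Rbar_interval lo hi w ->
  orthonormal_pair (f w) (vDerive f w))
  by (intros w; now apply deSitter_orthonormal).
assert (Hf := smooth_on_is_vderive _ f v (proj1 Hc) Hv).
assert (Ht := smooth_on_is_vderive _ _ v (smooth_on_vDerive _ f (proj1 Hc)) Hv).
assert (Hloc := locally_Rbar_interval _ _ _ Hv).
assert (E1 := mdot_locally_constant f (vDerive f) 0 v _ _ Hf Ht
  (filter_imp _ _ (fun w Hw => proj2 (proj2 (Hon w Hw))) Hloc)).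
assert (E2 := mdot_locally_constant (vDerive f) (vDerive f) 1 v _ _ Ht Ht
  (filter_imp _ _ (fun w Hw => proj1 (proj2 (Hon w Hw))) Hloc)).
destruct (Hon v Hv) as (Hff & Htt & Hft).
rewrite (orthonormal_expansion (f v) (vDerive f v)) at 1 by now apply Hon.
unfold geodesic_curvature, conormal.
set (q := vDerive (vDerive f) v) in *.
assert (E3 : mdot q (f v) = -1).
{ rewrite Htt in E1.
  replace (mdot q (f v)) with (mdot (f v) q) by (vec_unfold; ring); lra. }
assert (E4 : mdot q (vDerive f v) = 0).
{ replace (mdot (vDerive f v) q) with (mdot q (vDerive f v)) in E2
    by (vec_unfold; ring); lra. }
rewrite E3, E4; vec_ring.
Qed.

Lemma is_vderive_conormal (lo hi : Rbar) (f : R -> vec) (v : R) :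
  spacelike_curve (Rbar_interval lo hi) f ->
  unit_speed (Rbar_interval lo hi) f ->
  on_deSitter (Rbar_interval lo hi) f ->
  Rbar_interval lo hi v ->
  is_vderive (conormal f) v (scal (- geodesic_curvature f v) (vDerive f v)).
Proof.
intros Hc Hu Hd Hv.
assert (Hf := smooth_on_is_vderive _ f v (proj1 Hc) Hv).
assert (Ht := smooth_on_is_vderive _ _ v (smooth_on_vDerive _ f (proj1 Hc)) Hv).
destruct (deSitter_orthonormal lo hi f v Hc Hu Hd Hv) as (Hff & Htt & Hft).
replace (scal (- geodesic_curvature f v) (vDerive f v))
  with (plus (cross (vDerive f v) (vDerive f v))
             (cross (f v) (vDerive (vDerive f) v))).
{ now apply is_vderive_cross. }
rewrite (vDerive_tangent lo hi) by assumption.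
set (k := geodesic_curvature f v).
transitivity (scal (- k) (cross (f v) (conormal f v))); [vec_ring|].
unfold conormal; rewrite cross_cross, Hff, Hft; vec_ring.
Qed.

Lemma continuous_geodesic_curvature (I : R -> Prop) (f : R -> vec) (v : R) :
  smooth_on I f -> I v -> continuous (geodesic_curvature f) v.
Proof.
intros Hs Hv.
assert (Hs1 := smooth_on_vDerive _ _ Hs).
assert (Hs2 := smooth_on_vDerive _ _ Hs1).
apply continuous_ext with
  (f := fun w => mdot (cross (f w) (vDerive f w)) (vDerive (vDerive f) w)).
{ intros w; unfold geodesic_curvature; now apply cross_spec. }
apply (ex_derive_continuous (V := R_NormedModule)).
eexists; apply is_derive_mdot.
- apply is_vderive_cross; eapply smooth_on_is_vderive; eassumption.
- eapply smooth_on_is_vderive; eassumption.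
Qed.

(** * Frenet apparatus of the associated curve *)

Lemma tanh_square_lt_1 (x : R) : tanh x ^ 2 < 1.
Proof.
assert (Hp : 0 < exp x) by apply exp_pos.
assert (Hn : 0 < exp (- x)) by apply exp_pos.
assert (H : 1 - tanh x ^ 2 =
  4 * (exp x * exp (- x)) / (exp x + exp (- x)) ^ 2).
{ unfold tanh, sinh, cosh; field; lra. }
enough (0 < 1 - tanh x ^ 2) by lra.
rewrite H; apply Rdiv_lt_0_compat.
- apply Rmult_lt_0_compat; [lra|now apply Rmult_lt_0_compat].
- apply pow_lt; lra.
Qed.

Lemma is_vderive_gamma_tilde (lo hi : Rbar) (f : R -> vec) (a xi v : R) :
  Rbar_interval lo hi 0 ->
  spacelike_curve (Rbar_interval lo hi) f ->
  unit_speed (Rbar_interval lo hi) f ->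
  on_deSitter (Rbar_interval lo hi) f ->
  Rbar_interval lo hi v ->
  is_vderive (gamma_tilde f a xi) v
    (scal a (plus (f v) (scal (tanh xi) (conormal f v)))).
Proof.
intros H0 Hc Hu Hd Hv.
replace (scal a (plus (f v) (scal (tanh xi) (conormal f v))))
  with (plus (scal a (f v)) (scal (a * tanh xi) (conormal f v))) by vec_ring.
apply is_vderive_plus; apply is_vderive_scal.
- apply (is_vderive_vRInt lo hi f (vDerive f)); trivial.
  intros w Hw; exact (smooth_on_is_vderive _ f w (proj1 Hc) Hw).
- apply (is_vderive_vRInt lo hi (conormal f)
    (fun w => scal (- geodesic_curvature f w) (vDerive f w))); trivial.
  intros w Hw; now apply (is_vderive_conormal lo hi).
Qed.

Lemma mdot_tangent_direction (p q : vec) (T : R) :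
  orthonormal_pair p q ->
  mdot (plus p (scal T (cross p q))) (plus p (scal T (cross p q))) = 1 - T ^ 2.
Proof.
intros (Hp & Hq & Hpq).
transitivity (mdot p p + T ^ 2 * mdot (cross p q) (cross p q)).
- vec_unfold; ring.
- rewrite mdot_cross_cross, Hp, Hq, Hpq; ring.
Qed.

Lemma locally_sign_constant (q : R -> R) (v : R) :
  continuous q v -> q v <> 0 ->
  exists d, d ^ 2 = 1 /\ locally v (fun w => 0 < d * q w).
Proof.
intros Hc Hq.
destruct (Rdichotomy _ _ Hq) as [H|H].
- exists (-1); split; [ring|].
  generalize (Hc _ (open_lt 0 (q v) H)); unfold filtermap.
  apply filter_imp; intros w Hw; lra.
- exists 1; split; [ring|].
  generalize (Hc _ (open_gt 0 (q v) H)); unfold filtermap.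
  apply filter_imp; intros w Hw; lra.
Qed.

(** The Darboux vector computed in the frame [(f, t, s) = (p, q, p x q)].
    Since [s] is time-like, [q x s = - p], so the binormal is
    [- d b (s + T p)] and the torsion is [b (k - T) / c].  In the combination
    the terms in [T] alone cancel and those in [k] and [1] both acquire the
    factor [b^2 (1 - T^2) = 1]; the sign [d] occurs squared. *)
Lemma darboux_algebra (p q : vec) (b c d k T : R) :
  orthonormal_pair p q -> c <> 0 -> d ^ 2 = 1 -> b ^ 2 * (1 - T ^ 2) = 1 ->
  let s := cross p q in
  let tangent := scal b (plus p (scal T s)) in
  let binormal := cross (scal d q) tangent in
  let normal' := scal (/ c) (scal d (minus (opp p) (scal k s))) in
  plus (scal (- - mdot normal' binormal) tangent)
       (scal (/ c * (d * (b * (1 - k * T)))) binormal)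
  = scal (- / c) (plus (scal k p) s).
Proof.
intros (Hp & Hq & Hpq) Hc Hd Hb s tangent binormal normal'.
assert (Hps : mdot p s = 0) by (unfold s; vec_unfold; ring).
assert (Hss : mdot s s = -1).
{ unfold s; rewrite mdot_cross_cross, Hp, Hq, Hpq; ring. }
assert (Hqs : cross q s = opp p).
{ unfold s; rewrite cross_cross, Hq.
  replace (mdot q p) with (mdot p q) by (vec_unfold; ring).
  rewrite Hpq; vec_ring. }
assert (HB : binormal = scal (- (d * b)) (plus s (scal T p))).
{ transitivity (scal (d * b) (plus (opp s) (scal T (cross q s)))).
  - unfold binormal, tangent, s; vec_ring.
  - rewrite Hqs; vec_ring. }
assert (Htau : mdot normal' binormal = / c * (d ^ 2 * (b * (T - k)))).
{ rewrite HB.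
  transitivity (/ c * (d ^ 2 * (b *
    (T * mdot p p + (1 + k * T) * mdot p s + k * mdot s s)))).
  - unfold normal'; vec_unfold; ring.
  - rewrite Hp, Hps, Hss; ring. }
rewrite Htau, HB.
transitivity
  (scal (- / c * (d ^ 2 * (b ^ 2 * (1 - T ^ 2)))) (plus (scal k p) s)).
- unfold tangent; vec_ring.
- rewrite Hd, Hb; vec_ring.
Qed.

(** The curve is known through its derivative in a parameter proportional to
    arc length; [b (1 - k T) <> 0] is the non-vanishing of its curvature. *)
Lemma darboux_vector_of_tangent
    (lo hi : Rbar) (f alpha : R -> vec) (b c T v : R) :
  let k := geodesic_curvature f in
  spacelike_curve (Rbar_interval lo hi) f ->
  unit_speed (Rbar_interval lo hi) f ->
  on_deSitter (Rbar_interval lo hi) f ->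
  0 < c -> b ^ 2 * (1 - T ^ 2) = 1 ->
  (forall w, Rbar_interval lo hi w ->
     Tvec alpha (c * w) = scal b (plus (f w) (scal T (conormal f w)))) ->
  Rbar_interval lo hi v ->
  vDerive (Tvec alpha) (c * v) <> zero ->
  darboux_vector alpha (c * v) =
  scal (- / c) (plus (scal (k v) (f v)) (conormal f v)).
Proof.
intros k Hc Hu Hd Hc0 Hb HT Hv Hne.
assert (Hcn : c <> 0) by lra.
assert (Hloc := locally_Rbar_interval _ _ _ Hv).
set (q := fun w => b * (1 - k w * T)).
assert (HT' : forall w, Rbar_interval lo hi w ->
  vDerive (Tvec alpha) (c * w) = scal (/ c) (scal (q w) (vDerive f w))).
{ intros w Hw.
  apply is_vderive_unique.
  apply is_vderive_rescale with
    (g := fun w => scal b (plus (f w) (scal T (conormal f w)))).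
  - exact Hcn.
  - exact (filter_imp _ _ HT (locally_Rbar_interval _ _ _ Hw)).
  - replace (scal (q w) (vDerive f w)) with
      (scal b (plus (vDerive f w) (scal T (scal (- k w) (vDerive f w)))))
      by (unfold q; vec_ring).
    apply is_vderive_scal, is_vderive_plus.
    + exact (smooth_on_is_vderive _ f w (proj1 Hc) Hw).
    + apply is_vderive_scal; now apply (is_vderive_conormal lo hi). }
destruct (locally_sign_constant q v) as (d & Hd2 & Hdq).
{ unfold q; apply (continuous_scal_r (V := R_NormedModule)).
  apply (continuous_minus (V := R_NormedModule)); [apply continuous_const|].
  apply (continuous_mult (K := R_AbsRing)); [|apply continuous_const].
  exact (continuous_geodesic_curvature _ f v (proj1 Hc) Hv). }
{ intros E; apply Hne; rewrite HT' by exact Hv; rewrite E; vec_ring. }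
(* As [d = 1] or [d = -1], the number [d * q w] is the absolute value of
   [q w]. *)
assert (Hcurv : forall w, Rbar_interval lo hi w -> 0 < d * q w ->
  pnorm (vDerive (Tvec alpha) (c * w)) = / c * (d * q w)).
{ intros w Hw Hpos.
  rewrite HT' by exact Hw.
  rewrite !pnorm_scal.
  destruct (deSitter_orthonormal lo hi f w Hc Hu Hd Hw) as (_ & Htt & _).
  unfold pnorm at 1; rewrite Htt, Rabs_R1, sqrt_1.
  rewrite (Rabs_pos_eq (/ c)) by (left; now apply Rinv_0_lt_compat).
  assert (Habs : Rabs (q w) = d * q w).
  { rewrite <- (Rabs_pos_eq (d * q w)) by lra.
    rewrite Rabs_mult.
    replace (Rabs d) with 1; [ring|].
    rewrite <- sqrt_1, <- Hd2, <- Rsqr_pow2; apply sqrt_Rsqr_abs. }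
  rewrite Habs; ring. }
assert (HN : locally v (fun w => Nvec alpha (c * w) = scal d (vDerive f w))).
{ generalize (filter_and _ _ Hloc Hdq); apply filter_imp.
  intros w [Hw Hpos].
  unfold Nvec; fold (Tvec alpha).
  rewrite Hcurv by assumption.
  rewrite HT' by exact Hw.
  assert (Hinv : / (/ c * (d * q w)) * / c * q w = d).
  { assert (Hd0 : d <> 0) by (intros E; rewrite E in Hpos; lra).
    assert (Hq0 : q w <> 0) by (intros E; rewrite E in Hpos; lra).
    transitivity (d ^ 2 / d); [|now field].
    rewrite Hd2; now field. }
  rewrite <- Hinv at 2; vec_ring. }
assert (Hon := deSitter_orthonormal lo hi f v Hc Hu Hd Hv).
assert (HN' : vDerive (Nvec alpha) (c * v) =
  scal (/ c) (scal d (minus (opp (f v)) (scal (k v) (conormal f v))))).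
{ apply is_vderive_unique.
  apply is_vderive_rescale with (g := fun w => scal d (vDerive f w)).
  - exact Hcn.
  - exact HN.
  - apply is_vderive_scal.
    unfold k; rewrite <- (vDerive_tangent lo hi) by assumption.
    exact (smooth_on_is_vderive _ _ v (smooth_on_vDerive _ f (proj1 Hc)) Hv). }
unfold darboux_vector, torsion, Bvec, curvature.
rewrite HN', (locally_singleton _ _ HN), HT by exact Hv.
rewrite Hcurv by (exact Hv || exact (locally_singleton _ _ Hdq)).
now apply darboux_algebra.
Qed.

Lemma pnorm_evolute_direction (p q : vec) (k : R) :
  orthonormal_pair p q -> k ^ 2 > 1 ->
  pnorm (plus (scal k p) (cross p q)) = sqrt (k ^ 2 - 1).
Proof.
intros (Hp & Hq & Hpq) Hk.
unfold pnorm; f_equal.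
replace (mdot (plus (scal k p) (cross p q)) (plus (scal k p) (cross p q)))
  with (k ^ 2 * mdot p p + mdot (cross p q) (cross p q))
  by (vec_unfold; ring).
rewrite mdot_cross_cross, Hp, Hq, Hpq.
rewrite Rabs_pos_eq; lra.
Qed.

Theorem proposition4 (lo hi : Rbar) (f : R -> vec) (a theta u : R)
    (I := Rbar_interval lo hi) (xi1 := tanh theta * ln u)
    (h0 : I 0)
    (hf_curve : spacelike_curve I f)
    (hf_unit : unit_speed I f)
    (hf_deSitter : on_deSitter I f)
    (hkg : forall v, I v -> geodesic_curvature f v ^ 2 > 1)
    (ha : a <> 0) (htheta : theta <> 0) (hu : u > 0)
    (hbertrand : spacelike_bertrand I (gamma_tilde f a xi1)) :
  forall v, I v ->
    deSitter_darboux_image I (gamma_tilde f a xi1) v = deSitter_evolute f v.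
Proof.
intros v Hv.
assert (Hon : forall w, I w -> orthonormal_pair (f w) (vDerive f w))
  by (intros w; now apply deSitter_orthonormal).
destruct hbertrand as (_ & Hne & _).
set (gamma := gamma_tilde f a xi1) in *.
set (alpha := arclength_reparam I gamma) in *.
assert (HT2 : 0 < 1 - tanh xi1 ^ 2) by (generalize (tanh_square_lt_1 xi1); lra).
set (c := Rabs a * sqrt (1 - tanh xi1 ^ 2)).
assert (Hc : 0 < c).
{ apply Rmult_lt_0_compat; [now apply Rabs_pos_lt|now apply sqrt_lt_R0]. }
assert (Hcn : c <> 0) by lra.
assert (Hc2 : c ^ 2 = a ^ 2 * (1 - tanh xi1 ^ 2)).
{ unfold c; rewrite Rpow_mult_distr, pow2_abs, pow2_sqrt by lra; ring. }
assert (Hgamma : forall w, I w -> is_vderive gamma w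
  (scal a (plus (f w) (scal (tanh xi1) (conormal f w)))))
  by (intros w; now apply is_vderive_gamma_tilde).
assert (Hlen : forall w, I w -> arclength gamma w = c * w).
{ intros w; apply arclength_constant_speed; [exact h0|].
  clear w; intros w Hw.
  rewrite (is_vderive_unique _ _ _ (Hgamma w Hw)), pnorm_scal.
  unfold pnorm, conormal; rewrite mdot_tangent_direction by now apply Hon.
  now rewrite (Rabs_pos_eq (1 - _)) by lra. }
assert (HT : forall w, I w -> Tvec alpha (c * w) =
  scal (a / c) (plus (f w) (scal (tanh xi1) (conormal f w)))).
{ intros w Hw.
  replace (scal (a / c) (plus (f w) (scal (tanh xi1) (conormal f w))))
    with (scal (/ c) (scal a (plus (f w) (scal (tanh xi1) (conormal f w)))))
    by (unfold Rdiv; vec_ring).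
  apply is_vderive_unique, is_vderive_rescale with (g := gamma);
    [exact Hcn| |now apply Hgamma].
  generalize (locally_Rbar_interval _ _ _ Hw); apply filter_imp.
  intros z; now apply arclength_reparam_constant_speed. }
unfold deSitter_darboux_image, deSitter_evolute, darboux_image; fold alpha.
destruct (Hne v Hv) as [_ Hne0].
rewrite Hlen in Hne0 |- * by exact Hv.
rewrite (darboux_vector_of_tangent lo hi f alpha (a / c) c (tanh xi1) v);
  trivial.
2: { replace ((a / c) ^ 2) with (a ^ 2 / c ^ 2) by now field.
     rewrite Hc2; field; split; [lra|exact ha]. }
rewrite pnorm_scal, Rabs_Ropp, Rabs_pos_eq
  by (left; now apply Rinv_0_lt_compat).
unfold conormal.
rewrite pnorm_evolute_direction by (now apply Hon || now apply hkg).
set (k := geodesic_curvature f v).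
assert (Hk : k ^ 2 > 1) by now apply hkg.
assert (Hs : 0 < sqrt (k ^ 2 - 1)) by (apply sqrt_lt_R0; lra).
replace (/ (/ c * sqrt (k ^ 2 - 1))) with (c * / sqrt (k ^ 2 - 1))
  by (field; lra).
transitivity (scal (c * / c * / sqrt (k ^ 2 - 1))
  (minus (scal (- k) (f v)) (cross (f v) (vDerive f v)))); [vec_ring|].
now rewrite Rinv_r, Rmult_1_l.
Qed.
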